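(* Let $\mathcal{T}$ be a stacked component (with vertex set $\{0,1,\dots,2\,\mathrm{ord}(\ell)-1\}$ and edges as specified in the context), and let $v\in V(\mathcal{T})$. Then $$\mathrm{ecc}(v)=\begin{cases}\frac12(\mathrm{ord}(\ell)+1) & \text{if } 2\nmid v,\\ \frac12(\mathrm{ord}(\ell)+3) & \text{if } 2\mid v.\end{cases}$$
   Context: Let $p$ be a prime with $p\equiv 71$ or $119\pmod{120}$, let $\ell=2$, and let $\mathrm{ord}(\ell)$ be the order, in the ideal class group of $\mathbb{Q}(\sqrt{-p})$, of a prime ideal above $2$; it is an odd integer $\ge 3$. A stacked component $\mathcal{T}$ (a component of the supersingular $2$-isogeny graph over $\mathbb{F}_p$ after identifying curves up to $\overline{\mathbb{F}_p}$-isomorphism, regarded as a simple undirected graph) is, writing $L=\mathrm{ord}(\ell)$, labelled so that $V(\mathcal{T})=\{0,1,\dots,2L-1\}$ and $$E(\mathcal{T})=\{\{2i,2i+1\}:0\le i\le L-1\}\cup\{\{2i+1,2i+3\}:0\le i\le L-2\}\cup\{\{2L-1,1\}\}.$$ The eccentricity $\mathrm{ecc}(v)$ is the maximum graph distance from $v$ to any vertex of $\mathcal{T}$. *)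

(* Defs.v *)
From HB Require Import structures.
From mathcomp Require Import all_boot all_order all_algebra all_field.

Set Implicit Arguments.
Unset Strict Implicit.
Unset Printing Implicit Defensive.

Import Order.TTheory GRing.Theory Num.Theory.

Section ClassOrder.

Local Open Scope ring_scope.

(* The imaginary quadratic field Q(sqrt(-p)) and its ring of integers are      *)
(* concrete subsets of algC; ideals are subsets of algC, compared pointwise.   *)

Definition quad_field (p : nat) (x : algC) : Prop :=
  exists a b : rat, x = ratr a + ratr b * sqrtC (- p%:R).

Definition ring_of_integers (p : nat) (x : algC) : Prop :=
  quad_field p x /\ x \in Aint.

Definition is_ideal (p : nat) (I : algC -> Prop) : Prop :=
  [/\ forall x, I x -> ring_of_integers p x,
      I 0,
      forall x y, I x -> I y -> I (x + y)
    & forall a x, ring_of_integers p a -> I x -> I (a * x)].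

Definition is_prime_ideal (p : nat) (P : algC -> Prop) : Prop :=
  [/\ is_ideal p P,
      ~ P 1
    & forall x y, ring_of_integers p x -> ring_of_integers p y ->
        P (x * y) -> P x \/ P y].

Definition lies_above (l : nat) (P : algC -> Prop) : Prop :=
  forall n : int, P n%:~R <-> (l%:Z %| n)%Z.

Definition ideal_mul (I J : algC -> Prop) (x : algC) : Prop :=
  exists2 s : seq (algC * algC),
    forall u, u \in s -> I u.1 /\ J u.2
    & x = \sum_(u <- s) u.1 * u.2.

Definition ideal_exp (p : nat) (I : algC -> Prop) (n : nat) : algC -> Prop :=
  iter n (ideal_mul I) (ring_of_integers p).

(* Equality in the ideal class group, whose elements are represented by        *)
(* nonzero integral ideals: a I = b J for some nonzero integers a, b of the    *)
(* field. The neutral class is that of the unit ideal.                         *)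
Definition same_ideal_class (p : nat) (I J : algC -> Prop) : Prop :=
  exists a b : algC,
    [/\ ring_of_integers p a /\ a != 0,
        ring_of_integers p b /\ b != 0
      & forall x, (exists2 y, I y & x = a * y) <-> (exists2 y, J y & x = b * y)].

Definition is_class_order (p : nat) (I : algC -> Prop) (L : nat) : Prop :=
  [/\ (0 < L)%N,
      same_ideal_class p (ideal_exp p I L) (ring_of_integers p)
    & forall n : nat, (0 < n < L)%N ->
        ~ same_ideal_class p (ideal_exp p I n) (ring_of_integers p)].

End ClassOrder.

Section GraphDistance.

Variables (T : finType) (e : rel T).

Definition has_walk (n : nat) (x y : T) : bool :=
  [exists w : n.-tuple T, path e x w && (last x w == y)].

(* Least length of a walk from x to y. A shortest walk has fewer than #|T|     *)
(* edges, so the value is #|T| exactly when y is not reachable from x.         *)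
Definition gdist (x y : T) : nat :=
  find (fun n => has_walk n x y) (iota 0 #|T|).

Definition ecc (x : T) : nat := \max_(y : T) gdist x y.

End GraphDistance.

Section StackedComponent.

Variable L : nat.

(* The unordered pair {a, b} as a subset of {0, ..., 2L - 1}. *)
Definition upair (a b : nat) : {set 'I_(2 * L)} :=
  [set u : 'I_(2 * L) | (u == a :> nat) || (u == b :> nat)].

Definition stacked_edges : {set {set 'I_(2 * L)}} :=
  [set upair (2 * i) (2 * i + 1) | i : 'I_L]
  :|: [set upair (2 * i + 1) (2 * i + 3) | i : 'I_(L - 1)]
  :|: [set upair (2 * L - 1) 1].

Definition stacked_adj : rel 'I_(2 * L) :=
  fun u v => (u != v) && ([set u; v] \in stacked_edges).

End StackedComponent.

(* Main.v *)
Require Import Defs.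
From HB Require Import structures.
From mathcomp Require Import all_boot all_order all_algebra all_field.
From mathcomp Require Import zify ring.

(* With s^2 = -p and w = (1 + s) / 2 the ring of integers is Z[w], and the sign
   of s can be chosen so that P = (2, w).  If P^n is principal, its generator
   a + b w has b odd and norm 2^n.  For n = 1 this gives (2a + b)^2 + p b^2 = 8,
   impossible as p > 8.  For n = 2m it gives, with x = 2a + b,
     p b^2 = (2^(m+1) - x) (2^(m+1) + x),
   a product of coprime factors, so one of them is p d^2 and the other t^2;
   then (t + d s) / 2 has norm 2^m and generates P^m, so n is not minimal.
   Hence the order L of P is odd and at least 3.  The graph is an L-cycle on the
   odd vertices 2i+1 with a pendant vertex 2i at each of them, which gives the
   distances, hence the eccentricities. *)

Import Order.TTheory GRing.Theory Num.Theory.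

(** * Coprime factorisations of y^2 and p y^2 *)

(** gcd(u, y)^2 = gcd(u^2, u y, y^2), and y^2 = u v makes this u gcd(u, y, v) = u. *)
Lemma coprime_mul_sqr (u v y : nat) :
  coprime u v -> u * v = y ^ 2 -> u = gcdn u y ^ 2.
Proof.
move=> co uv; apply/esym.
have -> : gcdn u y ^ 2 = gcdn (u * gcdn u y) (y * gcdn u y).
  by rewrite expnS expn1 muln_gcdl.
have yy : y * y = u * v by rewrite uv.
rewrite !muln_gcdr (mulnC y u) yy -(muln_gcdr u u y) -(muln_gcdr u y v).
by rewrite -muln_gcdr (gcdnC y v) gcdnACA (eqP co) gcd1n muln1.
Qed.

(** The prime p divides one of the factors; cancelling it there leaves coprime numbers with product
    y^2, so both are squares. *)
Lemma coprime_mul_prime_sqr (p u v y : nat) : prime p -> coprime u v ->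
  u * v = p * y ^ 2 ->
  exists s t, s * t = y /\
    ((u = p * s ^ 2 /\ v = t ^ 2) \/ (u = t ^ 2 /\ v = p * s ^ 2)).
Proof.
move=> pp.
have W (u' v' : nat) : p %| u' -> coprime u' v' -> u' * v' = p * y ^ 2 ->
  exists s t, [/\ s * t = y, u' = p * s ^ 2 & v' = t ^ 2].
  case/dvdnP=> q -> co; rewrite -mulnA mulnCA => /eqP.
  rewrite eqn_pmul2l ?prime_gt0 // => /eqP qv.
  have co' : coprime q v' by apply: coprime_dvdl co; apply: dvdn_mulr.
  exists (gcdn q y), (gcdn v' y).
  have q2 := coprime_mul_sqr _ _ _ co' qv.
  have v2 : v' = gcdn v' y ^ 2.
    by apply: (coprime_mul_sqr v' q); rewrite 1?coprime_sym // mulnC.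
  split=> //; last by rewrite mulnC {1}q2.
  apply/eqP; rewrite -eqn_sqr; apply/eqP.
  by rewrite expnMn -q2 -v2.
move=> co uv.
have : p %| u * v by rewrite uv dvdn_mulr.
rewrite Euclid_dvdM // => /orP[pu|pv].
  by have [s [t [st us vt]]] := W u v pu co uv; exists s, t; split=> //; left.
have [|s [t [st us vt]]] := W v u pv _ (etrans (mulnC _ _) uv).
  by rewrite coprime_sym.
by exists s, t; split=> //; right.
Qed.

(** The squared denominator of b is coprime to the squared numerator, hence divides p, which is
    squarefree. *)
Lemma sqr_mul_prime_int (p : nat) (b : rat) (M : int) : prime p ->
  (b ^+ 2 * p%:R = M%:~R)%R -> b \is a Num.int.
Proof.
move=> pp e.
have eZ : (numq b ^+ 2 * p%:Z = M * denq b ^+ 2)%R.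
  apply: (@intr_inj rat); rewrite !(rmorphM, rmorphXn) /= -e numqE.
  ring.
have eN : `|numq b| ^ 2 * p = `|M| * `|denq b| ^ 2.
  by have := congr1 absz eZ; rewrite !abszM -!mulnn.
have dp : `|denq b| ^ 2 %| p.
  have co : coprime (`|denq b| ^ 2) (`|numq b| ^ 2).
    by rewrite coprimeXl ?coprimeXr // coprime_sym coprime_num_den.
  by rewrite -(Gauss_dvdr _ co) eN; apply: dvdn_mull.
rewrite Qint_def; apply/eqP.
have dp1 : `|denq b| %| p by apply: dvdn_trans dp; rewrite dvdn_exp.
case/primeP: (pp) => p1 /(_ _ dp1) /orP[/eqP d1|/eqP dpE].
  by rewrite -[denq b]gtz0_abs ?denq_gt0 // d1.
have := dvdn_leq (prime_gt0 pp) dp.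
by rewrite dpE leqNgt -{1}(expn1 p) ltn_exp2l ?prime_gt1.
Qed.

(** * The ring of integers Z[w] *)

Section QuadraticIntegers.

Local Open Scope ring_scope.

Variables (p : nat) (k : int) (s : algC).
Hypotheses (p_prime : prime p) (s2 : s ^+ 2 = - p%:R) (pk : p%:Z + 1 = 4 * k).

(** The element a + b w with w = (1 + s) / 2. Here s is either square root of -p, its sign being
    fixed only once P is given, and k = (p + 1) / 4 is the norm of w, so w^2 = w - k. *)
Definition qint_of (a b : int) : algC := a%:~R + b%:~R * ((1 + s) / 2).
Notation E := qint_of.

Lemma qint_of_s (a b : int) : E a b = (2 * a + b)%:~R / 2 + b%:~R / 2 * s.
Proof. by rewrite /E rmorphD rmorphM /=; field. Qed.

Let pkC : s ^+ 2 = 1 - 4 * k%:~R.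
Proof.
have := congr1 (fun z : int => z%:~R : algC) pk.
rewrite rmorphD rmorphM /= => e; rewrite s2 -e; ring.
Qed.

Lemma qint_of_mul (a b c d : int) :
  E a b * E c d = E (a * c - k * b * d) (a * d + b * c + b * d).
Proof. by rewrite /E !(rmorphD, rmorphN, rmorphM) /=; field: pkC. Qed.

Lemma qint_of_add (a b c d : int) : E a b + E c d = E (a + c) (b + d).
Proof. by rewrite /E !rmorphD /=; ring. Qed.

Lemma qint_of_int (a : int) : a%:~R = E a 0.
Proof. by rewrite /E mul0r addr0. Qed.

Lemma sqrt_neg_nonreal : s \isn't Num.real.
Proof. by rewrite realEsqr s2 oppr_ge0 lern0 -lt0n prime_gt0. Qed.

Lemma qint_of_inj (a b c d : int) : E a b = E c d -> a = c /\ b = d.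
Proof.
rewrite /E => e.
have e' : (b - d)%:~R * s = (2 * (c - a) - (b - d))%:~R.
  apply/eqP; rewrite -subr_eq0; apply/eqP.
  transitivity (2 * (E a b - E c d)); last by rewrite /E e subrr mulr0.
  by rewrite /E !(rmorphD, rmorphN, rmorphM) /=; field.
have [bd|bd] := eqVneq (b - d) 0.
  have bdE : b = d by lia.
  by move: e; rewrite bdE => /addIr /intr_inj ->.
case/negP: sqrt_neg_nonreal.
have -> : s = (2 * (c - a) - (b - d))%:~R / (b - d)%:~R.
  by rewrite -e' mulrC mulKf // intr_eq0.
by rewrite rpred_div // realz.
Qed.

Lemma qint_of_Aint (a b : int) : E a b \in Aint.
Proof.
have wA : (1 + s) / 2 \in Aint.
  (* The minimal polynomial X^2 - X + k of w. *)
  pose q : {poly int} := ('X - 1%:P) * 'X + k%:P.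
  apply: (@root_monic_Aint (map_poly intr q)).
  - rewrite rootE /q rmorphD rmorphM rmorphB /= !map_polyC map_polyX !hornerE /=.
    by apply/eqP; field: pkC.
  - apply: monic_map; rewrite monicE lead_coefDl ?lead_coefMX ?lead_coefXsubC //.
    by rewrite size_mulX ?polyXsubC_eq0 // size_XsubC size_polyC; case: eqP.
  - by apply/polyOverP=> i; rewrite coef_map intr_int.
by rewrite /E rpredD ?Aint_int // rpredM ?Aint_int.
Qed.

(** The trace A = 2a and the norm N = a^2 + p b^2 are rational algebraic integers, hence integers.
    Then p (2b)^2 is an integer, so B = 2b is one too, and A^2 + p B^2 = 4N with p = -1 mod 4 forces
    A and B to have the same parity. *)
Lemma Aint_qint_of (x : algC) : (exists a b : rat, x = ratr a + ratr b * s) ->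
  x \in Aint -> exists a b, x = E a b.
Proof.
case=> a [b xE] xA.
have sC : s^* = - s.
  have : (s^*) ^+ 2 = s ^+ 2 by rewrite -rmorphXn /= s2 rmorphN rmorph_nat.
  move/eqP; rewrite eqf_sqr => /orP[|/eqP//].
  by rewrite -CrealE (negPf sqrt_neg_nonreal).
have xC : x^* = ratr a - ratr b * s.
  by rewrite xE rmorphD [X in _ + X]rmorphM /= sC !(fmorph_rat Num.conj) mulrN.
have xCA : x^* \in Aint by rewrite Aint_aut.
have [A AE] : exists A : int, 2 * a = A%:~R.
  apply/intrP; rewrite -Cint_rat; apply: Cint_rat_Aint; first exact: Crat_rat.
  have -> : ratr (2 * a) = x + x^*.
    by rewrite xC xE rmorphM /= ratr_nat; ring.
  by rewrite rpredD.
have [N NE] : exists N : int, a ^+ 2 + p%:R * b ^+ 2 = N%:~R.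
  apply/intrP; rewrite -Cint_rat; apply: Cint_rat_Aint; first exact: Crat_rat.
  have -> : ratr (a ^+ 2 + p%:R * b ^+ 2) = x * x^*.
    by rewrite xC xE rmorphD rmorphM !rmorphXn /= ratr_nat; ring: s2.
  by rewrite rpredM.
have [B BE] : exists B : int, 2 * b = B%:~R.
  have e : (2 * b) ^+ 2 * p%:R = (4 * N - A ^+ 2)%:~R.
    by rewrite rmorphB rmorphM rmorphXn /= -NE -AE; ring.
  by apply/intrP; apply: (sqr_mul_prime_int _ _ _ p_prime e).
have AB : A ^+ 2 + p%:Z * B ^+ 2 = 4 * N.
  apply: (@intr_inj rat).
  by rewrite !(rmorphD, rmorphM, rmorphXn) /= -AE -BE -NE; ring.
have [c cE] : exists c, A - B = 2 * c.
  have [c [cE|cE]] : exists c, A - B = 2 * c \/ A - B = 2 * c + 1.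
    by exists ((A - B) %/ 2)%Z; lia.
    by exists c.
  have AcE : A = B + (2 * c + 1) by lia.
  have pE : p%:Z = 4 * k - 1 by lia.
  have : 1 + 2 * (B + 2 * (c ^+ 2 + c + B * c + k * B ^+ 2 - N)) = 0.
    by rewrite -[RHS](subrr (4 * N)) -{1}AB pE AcE; ring.
  by move: (B + _) => z; lia.
exists c, B; rewrite xE /E.
have -> : a = (2 * c + B)%:~R / 2 by rewrite -cE subrK -AE; field.
have -> : b = B%:~R / 2 by rewrite -BE; field.
have half (m : int) : ratr (m%:~R / 2) = m%:~R / 2 :> algC.
  by rewrite fmorph_div /= ratr_int ratr_nat.
by rewrite !half rmorphD rmorphM /=; field.
Qed.

(** The field is defined through [sqrtC], whereas s may be the opposite root; negating the
    coefficient of s absorbs the difference. *)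
Lemma ring_of_integersP (x : algC) :
  ring_of_integers p x <-> exists a b, x = E a b.
Proof.
have sE : s = sqrtC (- p%:R) \/ s = - sqrtC (- p%:R).
  have : s ^+ 2 = sqrtC (- p%:R) ^+ 2 by rewrite sqrtCK.
  by move/eqP; rewrite eqf_sqr => /orP[/eqP|/eqP]; [left|right].
split=> [[[a [b xE]] xA]|[a [b ->]]].
  apply: Aint_qint_of => //; case: sE => sE.
    by exists a, b; rewrite sE.
  by exists a, (- b); rewrite sE rmorphN mulrNN.
split; last exact: qint_of_Aint.
have EE : E a b = ratr ((2 * a + b)%:~R / 2) + ratr (b%:~R / 2) * s.
  by rewrite qint_of_s !fmorph_div /= !ratr_int !ratr_nat.
case: sE => sE; rewrite EE sE; first by do 2!eexists.
by exists ((2 * a + b)%:~R / 2), (- (b%:~R / 2)); rewrite rmorphN mulrN mulNr.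
Qed.

(** * Powers of the prime (2, w) *)

Hypothesis k_even : (2 %| k)%Z.

(** Hensel lifting of the root 0 modulo 2: for f(r) = r^2 - r + k one has f(r + f(r)) = (2r + f(r))
    f(r), and 2r + f(r) is even. *)
Lemma even_root_mod (n : nat) :
  exists r : int, (2 %| r)%Z /\ (2 ^+ n %| r ^+ 2 - r + k)%Z.
Proof.
elim: n => [|n [r [/dvdzP[r' rE] rn]]]; first by exists 0; rewrite expr0 dvd1z.
have f2 : (2 %| r ^+ 2 - r + k)%Z.
  rewrite rpredD //; apply/dvdzP; exists (2 * r' ^+ 2 - r'); rewrite rE; ring.
set f := r ^+ 2 - r + k in rn f2; exists (r + f); split.
  by rewrite rpredD // rE dvdz_mull.
have -> : (r + f) ^+ 2 - (r + f) + k = (2 * r + f) * f by rewrite /f; ring.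
by rewrite exprS dvdz_mul // rpredD // dvdz_mulr.
Qed.

Variable P : algC -> Prop.
Hypothesis PP : forall x, P x <-> exists a b, x = E a b /\ (2 %| a)%Z.

(* As r is a root of the minimal polynomial X^2 - X + k of w modulo 2^n,
   a + b w |-> a + b r is a ring morphism Z[w] -> Z/2^n; its kernel is P^n. *)
Lemma ideal_expP (n : nat) (r : int) :
  (2 %| r)%Z -> (2 ^+ n %| r ^+ 2 - r + k)%Z ->
  forall x, ideal_exp p P n x <->
    exists a b, x = E a b /\ (2 ^+ n %| a + b * r)%Z.
Proof.
move=> r2; elim: n => [|n IHn] rn x.
  rewrite /ideal_exp /= ring_of_integersP; split=> -[a [b]].
    by move=> ->; exists a, b; rewrite expr0 dvd1z.
  by case=> -> _; exists a, b.
have rn' : (2 ^+ n %| r ^+ 2 - r + k)%Z.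
  by apply: dvdz_trans rn; rewrite exprS dvdz_mull.
have {}IHn := IHn rn'.
rewrite /ideal_exp iterS -/(ideal_exp p P n); split.
  case=> u; elim: u x => [|[y z] u IHu] x yzP ->.
    by exists 0, 0; rewrite big_nil mul0r addr0 dvdz0 -qint_of_int.
  have [t tu|a [b [uE uP]]] := IHu _ _ erefl.
    by apply: yzP; rewrite inE tu orbT.
  have [/= /PP[c [d [-> c2]]] /IHn[e [f [-> ef]]]] := yzP (y, z) (mem_head _ _).
  rewrite big_cons /= uE qint_of_mul qint_of_add.
  do 2!eexists; split; first by [].
  (* Multiplicativity of a + b w |-> a + b r, up to a multiple of r^2 - r + k. *)
  have -> : c * e - k * d * f + a + (c * f + d * e + d * f + b) * r =
    (c + d * r) * (e + f * r) - d * f * (r ^+ 2 - r + k) + (a + b * r) by ring.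
  apply: rpredD uP; apply: rpredB; last exact: dvdz_mull.
  by rewrite exprS; apply: dvdz_mul ef; apply: rpredD c2 _; apply: dvdz_mull.
case=> a [b [-> /dvdzP[q qE]]].
have /dvdzP[g gE] := rn.
have P2 : P (E 2 0) by apply/PP; exists 2, 0.
have Pr : P (E (- r) 1) by apply/PP; exists (- r), 1; rewrite rpredN.
have Pn c : ideal_exp p P n (E (- (c * r)) c).
  by apply/IHn; exists (- (c * r)), c; rewrite addNr dvdz0.
(* Here a + b w = 2^(n+1) q + b (w - r), and w - r = g 2^(n+1) + (w - r)^2 + 2 r (w - r). Each term
   is 2 or w - r, both in P, times an element of P^n. *)
exists [:: (E 2 0, E (2 ^+ n * (q + b * g)) 0); (E (- r) 1, E (- (b * r)) b);
           (E 2 0, E (- (b * r * r)) (b * r))].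
  move=> u; rewrite !inE => /or3P[] /eqP -> /=; split=> //.
  apply/IHn; do 2!eexists; split; first by [].
  by rewrite mul0r addr0 dvdz_mulr.
rewrite !big_cons big_nil addr0 /= !qint_of_mul !qint_of_add.
have -> : a = q * 2 ^+ n.+1 - b * r by rewrite -qE addrK.
congr E; last by ring.
transitivity (q * 2 ^+ n.+1 - b * r + b * (g * 2 ^+ n.+1 - (r ^+ 2 - r + k))).
  by rewrite gE subrr mulr0 addr0.
by rewrite exprS; ring.
Qed.

(** If a I = b O, then b = a z for some z in I, and cancelling a shows that z generates I. *)
Lemma same_class_principal (I : algC -> Prop) :
  same_ideal_class p I (ring_of_integers p) ->
  exists2 z, I z & forall x, I x -> exists2 y, ring_of_integers p y & x = z * y.
Proof.
case=> a [b [[_ a0] _ abE]].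
have [|z Iz bE] := (abE b).2.
  by exists 1; rewrite ?mulr1 //;
    apply/ring_of_integersP; exists 1, 0; rewrite -qint_of_int.
exists z => // x Ix.
have [|y Oy axE] := (abE (a * x)).1; first by exists x.
by exists y => //; apply: (mulfI a0); rewrite axE bE mulrA.
Qed.

(** * Principal powers of P and elements of norm 2^n *)

Definition qnorm (a b : int) : int := a ^+ 2 + a * b + k * b ^+ 2.

Lemma qnorm4 (a b : int) : 4 * qnorm a b = (2 * a + b) ^+ 2 + p%:Z * b ^+ 2.
Proof.
have -> : p%:Z = 4 * k - 1 by lia.
by rewrite /qnorm; ring.
Qed.

Lemma qnorm_ge0 (a b : int) : 0 <= qnorm a b.
Proof.
have : 0 <= 4 * qnorm a b.
  rewrite qnorm4; apply: addr_ge0; first exact: sqr_ge0.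
  by apply: mulr_ge0 => //; apply: sqr_ge0.
by rewrite pmulr_rge0.
Qed.

(** A generator a + b w of P^n divides w - r, so a and b are not both even. It also divides 2^n, and
    its norm is M 2^n with M a power of 2 dividing its conjugate; hence M = 1. *)
Lemma principal_norm (n : nat) : (0 < n)%N ->
  same_ideal_class p (ideal_exp p P n) (ring_of_integers p) ->
  exists a b, [/\ (2 %| a)%Z, ~~ (2 %| b)%Z & qnorm a b = 2 ^+ n].
Proof.
move=> n0 /same_class_principal[z].
have [r [r2 rn]] := even_root_mod n.
have In := ideal_expP n r r2 rn.
case/In=> a [b [-> ab]] gen.
have {}gen e g : (2 ^+ n %| e + g * r)%Z ->
    exists c d, e = a * c - k * b * d /\ g = a * d + b * c + b * d.
  move=> eg; have [|y /ring_of_integersP[c [d ->]]] := gen (E e g).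
    by apply/In; exists e, g.
  by rewrite qint_of_mul => /qint_of_inj[-> ->]; exists c, d.
have [|c [d [cd1 cd2]]] := gen (2 ^+ n) 0; first by rewrite mul0r addr0.
have [|c' [d' [_ cd2']]] := gen (- r) 1; first by rewrite mul1r addNr.
have prim : (2 %| a)%Z -> (2 %| b)%Z -> False.
  by case/dvdzP=> a' aE /dvdzP[b' bE]; move: cd2'; rewrite aE bE; lia.
have /dvdzP[M ME] : (2 ^+ n %| qnorm a b)%Z.
  have -> : qnorm a b =
      (a + b * r) * (a + b - b * r) + b ^+ 2 * (r ^+ 2 - r + k).
    by rewrite /qnorm; ring.
  by apply: rpredD; [apply: dvdz_mulr|apply: dvdz_mull].
have T0 : (2 ^+ n : int) != 0 by rewrite expf_neq0.
(* With 2^n = (a + b w) (c + d w) and norm M 2^n, the conjugate a + b - b w equals M (c + d w);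
   these are its two coordinates. *)
have Mc : M * c = a + b.
  apply: (mulIf T0); rewrite mulrAC -ME cd1 /qnorm.
  transitivity ((a + b) * (a * c - k * b * d) + k * b * (a * d + b * c + b * d)).
    by ring.
  by rewrite -cd2 mulr0 addr0.
have Md : M * d = - b.
  apply: (mulIf T0); rewrite mulrAC -ME cd1 /qnorm.
  transitivity (- b * (a * c - k * b * d) + a * (a * d + b * c + b * d)).
    by ring.
  by rewrite -cd2 mulr0 addr0.
have MN : M * qnorm c d = 2 ^+ n.
  rewrite cd1 /qnorm; transitivity (M * c * c + M * d * (c + k * d)); first ring.
  by rewrite Mc Md; transitivity (a * c - k * b * d); first ring.
have /(dvdn_pfactor _ _ (isT : prime 2))[[|j] _ jE] : (`|M| %| 2 ^ n)%N.
- have <- : `|2 ^+ n : int|%N = (2 ^ n)%N by rewrite abszX.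
  by rewrite -MN abszM dvdn_mulr.
- have M0 : 0 <= M.
    have : 0 <= M * 2 ^+ n by rewrite -ME qnorm_ge0.
    by rewrite pmulr_lge0 // exprn_gt0.
  have M1 : M = 1 by rewrite -[M]gez0_abs // jE.
  have a2 : (2 %| a)%Z.
    have -> : a = (a + b * r) - b * r by rewrite addrK.
    rewrite rpredB ?dvdz_mull // (dvdz_trans _ ab) //.
    by rewrite -(prednK n0) exprS dvdz_mulr.
  exists a, b; split=> //; first by apply/negP => /(prim a2).
  by rewrite ME M1 mul1r.
have /dvdzP[M' M'E] : (2 %| M)%Z by rewrite dvdzE jE expnS dvdn_mulr.
have b2 : (2 %| b)%Z by rewrite -rpredN -Md M'E mulrAC dvdz_mull.
case: prim => //.
by rewrite -(addrK b a) rpredB // -Mc M'E mulrAC dvdz_mull.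
Qed.

Lemma norm_principal (n : nat) (a b : int) :
  (2 %| a)%Z -> ~~ (2 %| b)%Z -> qnorm a b = 2 ^+ n ->
  same_ideal_class p (ideal_exp p P n) (ring_of_integers p).
Proof.
move=> a2 b2 abn.
have [r [r2 rn]] := even_root_mod n.
have In := ideal_expP n r r2 rn.
have abr : (2 ^+ n %| a + b * r)%Z.
  (* The image of the conjugate is odd, so the factor 2^n of the norm divides the image of a + b w
     itself. *)
  have co : coprimez (2 ^+ n) (a + b - b * r).
    rewrite coprimezE abszX coprimeXl // prime_coprime // -dvdzE.
    apply: contra b2 => h; have -> : b = (a + b - b * r) - a + b * r by ring.
    by apply: rpredD; [apply: rpredB|apply: dvdz_mull].
  rewrite -(Gauss_dvdzl _ co).
  have -> : (a + b * r) * (a + b - b * r) =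
      qnorm a b - b ^+ 2 * (r ^+ 2 - r + k) by rewrite /qnorm; ring.
  by rewrite abn; apply: rpredB; rewrite // dvdz_mull.
exists 1, (E a b); split.
- split; last exact: oner_neq0.
  by apply/ring_of_integersP; exists 1, 0; rewrite -qint_of_int.
- split; first by apply/ring_of_integersP; exists a, b.
  have E0 : E 0 0 = 0 by rewrite -qint_of_int.
  by apply: contra b2 => /eqP; rewrite -E0 => /qint_of_inj[_ ->]; exact: dvdz0.
move=> x; split.
  case=> _ /In[e [g [-> eg]]] ->; rewrite mul1r.
  (* q1 and q2 are the coordinates of (e + g w) / (a + b w), that is, of (e + g w) (a + b - b w) /
     2^n. *)
  have /dvdzP[q1 q1E] : (2 ^+ n %| e * (a + b) + k * g * b)%Z.
    have -> : e * (a + b) + k * g * b =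
      (e + g * r) * (a + b - b * r) + g * b * (r ^+ 2 - r + k)
      - r * (g * (a + b * r) - b * (e + g * r)) by ring.
    apply: rpredB; first by apply: rpredD; [apply: dvdz_mulr|apply: dvdz_mull].
    by apply/dvdz_mull/rpredB; apply: dvdz_mull.
  have /dvdzP[q2 q2E] : (2 ^+ n %| g * a - e * b)%Z.
    have -> : g * a - e * b = g * (a + b * r) - b * (e + g * r) by ring.
    by apply: rpredB; apply: dvdz_mull.
  have T0 : (2 ^+ n : int) != 0 by rewrite expf_neq0.
  exists (E q1 q2); first by apply/ring_of_integersP; exists q1, q2.
  rewrite qint_of_mul; congr E; apply: (mulIf T0).
    transitivity (a * (q1 * 2 ^+ n) - k * b * (q2 * 2 ^+ n)); last by ring.
    by rewrite -q1E -q2E -abn /qnorm; ring.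
  transitivity (a * (q2 * 2 ^+ n) + b * (q1 * 2 ^+ n) + b * (q2 * 2 ^+ n)); last by ring.
  by rewrite -q1E -q2E -abn /qnorm; ring.
case=> _ /ring_of_integersP[c [d ->]] ->.
rewrite qint_of_mul; eexists; last by rewrite mul1r.
apply/In; do 2!eexists; split; first by [].
have -> : a * c - k * b * d + (a * d + b * c + b * d) * r =
  (a + b * r) * (c + d * r) - b * d * (r ^+ 2 - r + k) by ring.
by apply: rpredB; [apply: dvdz_mulr|apply: dvdz_mull].
Qed.

(** The element c + d w is a square root of a + b w or of its opposite. *)
Lemma qnorm_sqrt (m : nat) (a b : int) :
  (2 %| a)%Z -> ~~ (2 %| b)%Z -> qnorm a b = 2 ^+ m.*2 ->
  exists c d, [/\ (2 %| c)%Z, ~~ (2 %| d)%Z & qnorm c d = 2 ^+ m].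
Proof.
move=> a2 b2 abm.
pose x := 2 * a + b; pose T : int := 2 ^+ m.+1.
have TT : T ^+ 2 = x ^+ 2 + p%:Z * b ^+ 2.
  by rewrite -qnorm4 abm /T -exprM muln2 doubleS !exprS mulrA.
have T0 : 0 < T by rewrite exprn_gt0.
have xT : `|x| < T.
  rewrite -(@ltr_pXn2r _ 2) ?nnegrE ?normr_ge0 ?ltW // TT real_normK ?num_real //.
  rewrite ltrDl mulr_gt0 ?ltz_nat ?prime_gt0 // lt0r sqr_ge0 sqrf_eq0 andbT.
  by apply: contra b2 => /eqP ->; exact: dvdz0.
have x2 : ~~ (2 %| x)%Z.
  apply: contra b2 => xd; have -> : b = x - 2 * a by rewrite /x; ring.
  by apply: rpredB => //; apply: dvdz_mulr.
have [u uE] : exists u : nat, u%:Z = T - x by exists `|(T - x)%R|%N; lia.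
have [v vE] : exists v : nat, v%:Z = T + x by exists `|(T + x)%R|%N; lia.
have T2 : (2 %| T)%Z by rewrite /T exprS dvdz_mulr.
(* u + v is a power of 2, while u and v are odd because x is. *)
have co : coprime u v.
  have uv : (u + v = 2 ^ m.+2)%N.
    apply/eqP; rewrite -eqz_nat PoszD uE vE; apply/eqP.
    by rewrite -[Posz (2 ^ _)]natz natrX !exprS /T exprS; ring.
  have /(dvdn_pfactor _ _ (isT : prime 2))[[|j] _ gE] : (gcdn u v %| 2 ^ m.+2)%N.
  - by rewrite -uv dvdn_add ?dvdn_gcdl ?dvdn_gcdr.
  - by rewrite /coprime gE.
  case/negP: x2; have -> : x = T - u%:Z by rewrite uE; ring.
  apply: rpredB => //; rewrite dvdzE /=.
  by apply: dvdn_trans (dvdn_gcdl u v); rewrite gE expnS dvdn_mulr.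
have uv : (u * v = p * `|b| ^ 2)%N.
  apply/eqP; rewrite -eqz_nat -mulnn !PoszM uE vE; apply/eqP.
  rewrite -[_ * Posz `|b|%N]expr2 abszE real_normK ?num_real //.
  by transitivity (T ^+ 2 - x ^+ 2); [ring|rewrite TT addrC addKr].
have [s0 [t [st H]]] := coprime_mul_prime_sqr p u v `|b|%N p_prime co uv.
have [e [e2 be]] : exists e : int, e * e = 1 /\ `|b|%N%:Z = e * b.
  by have [b0|b0] := lerP 0 b; [exists 1|exists (-1)]; split=> //; clear -b0; lia.
have stZ : s0%:Z * t%:Z = e * b by rewrite -PoszM st.
(* The sign y records which factor is the square t^2. The sign of d is chosen so that ((t + d s) /
   2)^2 = y (a + b w). *)
have [d [y [y1 dt dp dm]]] : exists d y : int, [/\ y = 1 \/ y = - 1,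
    d * t%:Z = y * b, t%:Z ^+ 2 + p%:Z * d ^+ 2 = 2 * T
  & t%:Z ^+ 2 - p%:Z * d ^+ 2 = y * (2 * x)].
  case: H => -[uH vH]; rewrite uH vH PoszM -!mulnn !PoszM in uE vE.
    exists (e * s0%:Z), 1; split; first by left.
    - by rewrite -mulrA stZ mulrA e2.
    - transitivity (t%:Z * t%:Z + p%:Z * (s0%:Z * s0%:Z) * (e * e)); first by ring.
      by rewrite e2 mulr1 uE vE; ring.
    - transitivity (t%:Z * t%:Z - p%:Z * (s0%:Z * s0%:Z) * (e * e)); first by ring.
      by rewrite e2 mulr1 uE vE; ring.
  exists (- e * s0%:Z), (- 1); split; first by right.
  - by rewrite -mulrA stZ mulrA !mulNr e2.
  - transitivity (t%:Z * t%:Z + p%:Z * (s0%:Z * s0%:Z) * (e * e)); first by ring.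
    by rewrite e2 mulr1 uE vE; ring.
  - transitivity (t%:Z * t%:Z - p%:Z * (s0%:Z * s0%:Z) * (e * e)); first by ring.
    by rewrite e2 mulr1 uE vE; ring.
have dt2 : ~~ (2 %| d * t%:Z)%Z.
  by rewrite dt; case: y1 => ->; rewrite ?mul1r // mulN1r rpredN.
have d2 : ~~ (2 %| d)%Z by apply: contra dt2 => h; apply: dvdz_mulr.
have t2 : ~~ (2 %| t%:Z)%Z by apply: contra dt2 => h; apply: dvdz_mull.
have [c cE] : exists c, t%:Z = 2 * c + d by exists ((t%:Z - d) %/ 2)%Z; clear -d2 t2; lia.
have cd : qnorm c d = 2 ^+ m.
  apply: (@mulfI _ 4) => //; rewrite qnorm4 -cE dp /T exprS; ring.
exists c, d; split=> //.
(* The first coordinate of (c + d w)^2 = y (a + b w); as k and a are even, so is c. *)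
have c2 : c ^+ 2 = k * d ^+ 2 + y * a.
  apply: (@mulfI _ 4) => //.
  have -> : 4 * (k * d ^+ 2 + y * a) = (4 * k) * d ^+ 2 + y * (2 * x) - 2 * (y * b).
    by rewrite /x; ring.
  by rewrite -pk -dm -dt cE; ring.
have : (2 %| c ^+ 2)%Z.
  by rewrite c2; apply: rpredD; [apply: dvdz_mulr|apply: dvdz_mull].
by rewrite !dvdzE abszX Euclid_dvdX // => /andP[].
Qed.

Lemma class_order_odd_ge3 (L : nat) : (8 < p)%N -> is_class_order p P L ->
  odd L /\ (2 < L)%N.
Proof.
move=> p8 [L0 LO Lmin].
have [a [b [a2 b2 ab]]] := principal_norm L L0 LO.
have Lodd : odd L.
  apply/negPn/negP => /even_halfK LE.
  have h0 : (0 < L./2)%N by rewrite -double_gt0 LE.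
  rewrite -LE in ab; have [c [d [c2 d2 cd]]] := qnorm_sqrt _ _ _ a2 b2 ab.
  apply: (Lmin L./2); last exact: norm_principal c2 d2 cd.
  by rewrite h0 -{2}LE -addnn -{1}[L./2]addn0 ltn_add2l.
split=> //; case: L Lodd {L0 LO Lmin} ab => [|[|[|L]]] //= _ ab.
have := qnorm4 a b; rewrite ab expr1 => ab4.
have b1 : 1 <= b ^+ 2.
  rewrite -gtz0_ge1 lt0r sqr_ge0 sqrf_eq0 andbT.
  by apply: contra b2 => /eqP ->; exact: dvdz0.
have := sqr_ge0 (2 * a + b).
have : p%:Z <= p%:Z * b ^+ 2 by rewrite ler_peMr.
by move: (p%:Z * b ^+ 2) ((2 * a + b) ^+ 2) ab4 => X Y; lia.
Qed.

End QuadraticIntegers.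

(** * The prime ideals above 2 *)

Section PrimeAboveTwo.

Local Open Scope ring_scope.

(** The conjugates (1 + t) / 2 and (1 - t) / 2 have product k, which is even and so lies in P. By
    primality one of them is in P, and s is t or -t accordingly. Then a + b w is in P exactly when
    the integer a is. *)
Lemma prime_above_two (p : nat) (k : int) (P : algC -> Prop) :
  prime p -> p%:Z + 1 = 4 * k -> (2 %| k)%Z ->
  is_prime_ideal p P -> lies_above 2 P ->
  exists2 s : algC, s ^+ 2 = - p%:R &
    forall x, P x <-> exists a b, x = qint_of s a b /\ (2 %| a)%Z.
Proof.
move=> pp pk k2 [[PO P0 PD PM] _ Pprime] P2.
have [s s2 Pw] : exists2 s : algC, s ^+ 2 = - p%:R & P (qint_of s 0 1).
  pose t := sqrtC (- p%:R : algC).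
  have t2 : t ^+ 2 = - p%:R by rewrite sqrtCK.
  have Ot : ring_of_integers p (qint_of t 0 1).
    by apply/(ring_of_integersP p k t pp t2 pk); exists 0, 1.
  have Ot' : ring_of_integers p (qint_of (- t) 0 1).
    by apply/(ring_of_integersP p k (- t) pp _ pk); rewrite ?sqrrN //; exists 0, 1.
  have : P (qint_of t 0 1 * qint_of (- t) 0 1).
    have -> : qint_of t 0 1 * qint_of (- t) 0 1 = k%:~R; last exact/P2.
      apply: (@mulfI _ 4); first by rewrite pnatr_eq0.
      have := congr1 (fun z : int => z%:~R : algC) pk.
      rewrite rmorphD rmorphM /= => <-; rewrite /qint_of; field: t2.
    by [].
  case/(Pprime _ _ Ot Ot'); first by exists t.
  by exists (- t); rewrite // sqrrN.
exists s => // x.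
have OP := ring_of_integersP p k s pp s2 pk.
have Pb b : P (qint_of s 0 b).
  have -> : qint_of s 0 b = b%:~R * qint_of s 0 1 by rewrite /qint_of; ring.
  by apply: PM => //; apply/OP; exists b, 0; rewrite -qint_of_int.
split=> [Px|[a [b [-> a2]]]]; last first.
  have -> : qint_of s a b = a%:~R + qint_of s 0 b by rewrite /qint_of add0r.
  by apply: PD => //; apply/P2.
have /OP[a [b xE]] := PO x Px; exists a, b; split=> //.
apply/P2; have -> : a%:~R = x + qint_of s 0 (- b).
  by rewrite xE /qint_of rmorphN /=; ring.
exact: PD.
Qed.

End PrimeAboveTwo.

(** * Certifying a formula for the graph distance *)

Section Distance.

Variables (T : finType) (e : rel T) (D : T -> T -> nat).
Hypotheses (D0 : forall x, D x x = 0)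
  (D0_eq : forall x y, D x y = 0 -> x = y)
  (Dstep : forall x y z, e y z -> D x z <= (D x y).+1)
  (Dpred : forall x y, 0 < D x y -> exists2 z, e z y & D x y = (D x z).+1)
  (Dmax : forall x y, D x y < #|T|).

Lemma has_walk_le (n : nat) (x y : T) : has_walk e n x y -> D x y <= n.
Proof.
case/existsP=> -[w /= /eqP <-] /andP[ew /eqP <-].
elim/last_ind: w ew => [|w z IHw]; first by rewrite D0.
rewrite rcons_path last_rcons size_rcons => /andP[/IHw Dw ez].
by apply: leq_trans (Dstep _ _ _ ez) _.
Qed.

Lemma has_walk_pred (x y : T) : has_walk e (D x y) x y.
Proof.
have: exists2 w, size w = D x y & path e x w && (last x w == y).
  have [n Dn] : {n | D x y = n} by exists (D x y).
  rewrite Dn; elim: n y Dn => [|n IHn] y Dn.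
    by exists [::] => //=; apply/eqP/D0_eq.
  have [|z ez] := Dpred x y; first by rewrite Dn.
  rewrite Dn => -[/esym /IHn[w <- /andP[ew /eqP lw]]].
  by exists (rcons w y); rewrite ?size_rcons // rcons_path last_rcons ew lw ez eqxx.
case=> w sw ew; apply/existsP; have sw' : size w == D x y by rewrite sw.
by exists (Tuple sw').
Qed.

(** No walk is shorter than D, which grows by at most 1 along an edge; descending along [Dpred]
    gives a walk of length D. [Dmax] places this length in the range searched by [gdist]. *)
Lemma gdist_eq (x y : T) : gdist e x y = D x y.
Proof.
rewrite /gdist; set a := fun n => _; set s := iota _ _.
have hasa : has a s.
  by apply/hasP; exists (D x y); rewrite ?mem_iota ?Dmax // /a has_walk_pred.
apply/eqP; rewrite eqn_leq; apply/andP; split.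
  rewrite leqNgt; apply/negP => lt.
  have := before_find 0 lt; rewrite nth_iota ?Dmax // add0n /a.
  by rewrite has_walk_pred.
have := nth_find 0 hasa; rewrite nth_iota; last first.
  by rewrite -(size_iota 0 #|T|) -has_find.
by rewrite add0n => /has_walk_le.
Qed.

End Distance.

(** * Distances in the stacked component *)

Section Stacked.

Variable L : nat.
Hypotheses (Lodd : odd L) (L3 : 2 < L).

(** The distance on a cycle of length L; [maxn i j - minn i j] is |i - j| in truncated
    subtraction. *)
Definition cycle_dist (i j : nat) : nat :=
  minn (maxn i j - minn i j) (L - (maxn i j - minn i j)).

(** [u./2] is the position on the cycle, and an even end costs one more edge to leave its leaf. The
    case u = v is separate, since the sum would be 2 for a leaf and itself. *)
Definition stacked_dist (u v : 'I_(2 * L)) : nat :=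
  if u == v then 0 else cycle_dist u./2 v./2 + ~~ odd u + ~~ odd v.

Lemma upairP (a b : nat) (u v : 'I_(2 * L)) : u != v ->
  reflect ((u = a :> nat /\ v = b :> nat) \/ (u = b :> nat /\ v = a :> nat))
    ([set u; v] == upair L a b).
Proof.
move=> uv; apply: (iffP eqP) => [E|H].
  have := set21 u v; have := set22 u v; rewrite E !inE.
  have {}uv : u != v :> nat by [].
  by lia.
apply/setP=> z; rewrite !inE -!val_eqE /=.
by case: H => -[-> ->] //; rewrite orbC.
Qed.

Lemma stacked_adjP (u v : 'I_(2 * L)) :
  reflect (u <> v :> nat /\ (u./2 = v./2 \/ [/\ odd u, odd v & cycle_dist u./2 v./2 = 1]))
    (stacked_adj u v).
Proof.
apply: (iffP andP) => [[uv]|[uv H]].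
  have uvN : u <> v :> nat by apply/eqP.
  rewrite !inE => /orP[/orP[]|].
  - by case/imsetP=> i _ /eqP/(upairP _ _ _ _ uv) H; split=> //; left; lia.
  - case/imsetP=> i _ /eqP/(upairP _ _ _ _ uv) H; split=> //; right.
    have := ltn_ord i; rewrite /cycle_dist => iL; split; lia.
  - move/(upairP _ _ _ _ uv) => H; split=> //; right; rewrite /cycle_dist; split; lia.
have uv' : u != v by apply/eqP => uv'; apply: uv; rewrite uv'.
split=> //; rewrite !inE; have := ltn_ord u; have := ltn_ord v => vL uL.
case: H => [H|[ou ov H]].
  apply/orP; left; apply/orP; left; apply/imsetP.
  have iL : u./2 < L by lia.
  by exists (Ordinal iL) => //; apply/eqP/upairP => //=; lia.
rewrite /cycle_dist in H.
have : [\/ v = u + 2 :> nat, u = v + 2 :> nat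
         | (u = 2 * L - 1 :> nat /\ v = 1 :> nat) \/
           (v = 2 * L - 1 :> nat /\ u = 1 :> nat)].
  case: (ltngtP (val u) (val v)) => /= h.
  - have [?|?] : v./2 - u./2 = 1 \/ L - (v./2 - u./2) = 1 by lia.
      by constructor 1; lia.
    by constructor 3; lia.
  - have [?|?] : u./2 - v./2 = 1 \/ L - (u./2 - v./2) = 1 by lia.
      by constructor 2; lia.
    by constructor 3; lia.
  - by [].
case=> h.
- apply/orP; left; apply/orP; right; apply/imsetP.
  have iL : u./2 < L - 1 by lia.
  by exists (Ordinal iL) => //; apply/eqP/upairP => //=; lia.
- apply/orP; left; apply/orP; right; apply/imsetP.
  have iL : v./2 < L - 1 by lia.
  by exists (Ordinal iL) => //; apply/eqP/upairP => //=; lia.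
- by apply/orP; right; apply/upairP => //; lia.
Qed.

Lemma stacked_dist0 (x : 'I_(2 * L)) : stacked_dist x x = 0.
Proof. by rewrite /stacked_dist eqxx. Qed.

Lemma stacked_dist0_eq (x y : 'I_(2 * L)) : stacked_dist x y = 0 -> x = y.
Proof.
rewrite /stacked_dist; case: eqP => // /eqP; rewrite -val_eqE /= /cycle_dist => xy H.
have := ltn_ord x; have := ltn_ord y; lia.
Qed.

(** The four cases spell out i - j = d or -d modulo L; 2d < L makes d the shorter arc. *)
Lemma cycle_distP (i j d : nat) : i < L -> j < L -> 2 * d < L ->
  [\/ i = j + d, j = i + d, i + L = j + d | j + L = i + d] <-> cycle_dist i j = d.
Proof.
rewrite /cycle_dist => iL jL dL; split=> [H|<-]; first by case: H => H; lia.
case: (leqP i j) => ij.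
  case: (leqP (2 * (j - i)) L) => h; last by constructor 3; lia.
  by constructor 2; lia.
case: (leqP (2 * (i - j)) L) => h; last by constructor 4; lia.
by constructor 1; lia.
Qed.

(** Strict because L is odd: no two positions are antipodal. *)
Lemma cycle_dist_half (i j : nat) : i < L -> j < L -> 2 * cycle_dist i j < L.
Proof. rewrite /cycle_dist; lia. Qed.

Lemma cycle_dist_step (a i j : nat) : a < L -> i < L -> j < L ->
  cycle_dist i j = 1 -> cycle_dist a j <= (cycle_dist a i).+1.
Proof.
move=> aL iL jL /cycle_distP => /(_ iL jL L3) ij.
have ai := cycle_dist_half a i aL iL; have aj := cycle_dist_half a j aL jL.
move: (cycle_dist a i) (cycle_dist a j) ai aj
  (cycle_distP a i _ aL iL ai) (cycle_distP a j _ aL jL aj).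
move=> d d' dL dL' [_ /(_ erefl) H] [_ /(_ erefl) H'].
by case: ij; case: H; case: H'; lia.
Qed.

Lemma cycle_dist_pred (i j : nat) : i < L -> j < L -> i <> j ->
  exists j', [/\ j' < L, cycle_dist j' j = 1 & cycle_dist i j = (cycle_dist i j').+1].
Proof.
move=> iL jL ij; have dL := cycle_dist_half i j iL jL.
have [_ /(_ erefl)] := cycle_distP i j _ iL jL dL.
move: (cycle_dist i j) dL (erefl (cycle_dist i j)) => [|d] dL.
  by move=> _ H; case: H => H; lia.
move=> dE H.
have dL' : 2 * d < L by lia.
have step j' : j' < L ->
    [\/ i = j' + d, j' = i + d, i + L = j' + d | j' + L = i + d] ->
    [\/ j' = j + 1, j = j' + 1, j' + L = j + 1 | j + L = j' + 1] ->
  exists j', [/\ j' < L, cycle_dist j' j = 1 & d.+1 = (cycle_dist i j').+1].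
  move=> jL' H1 H2; exists j'; split=> //; first exact/cycle_distP.
  by congr _.+1; apply/esym/cycle_distP.
(* In each case j moves one step towards i along the shorter arc, wrapping around at L - 1 or at 0
   in the last two. *)
case: H => H.
- by apply: (step j.+1); [lia|constructor 1; lia|constructor 1; lia].
- by apply: (step j.-1); [lia|constructor 2; lia|constructor 2; lia].
- have [jl|jl] := eqVneq j.+1 L.
    by apply: (step 0); [lia|constructor 1; lia|constructor 3; lia].
  by apply: (step j.+1); [lia|constructor 3; lia|constructor 1; lia].
- have [j0|j0] := posnP j.
    by apply: (step L.-1); [lia|constructor 2; lia|constructor 4; lia].
  by apply: (step j.-1); [lia|constructor 4; lia|constructor 2; lia].
Qed.

Lemma stacked_dist_step (x y z : 'I_(2 * L)) :
  stacked_adj y z -> stacked_dist x z <= (stacked_dist x y).+1.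
Proof.
move/stacked_adjP; rewrite /stacked_dist -!val_eqE /=.
have xL : x./2 < L by have := ltn_ord x; lia.
have yL : y./2 < L by have := ltn_ord y; lia.
have zL : z./2 < L by have := ltn_ord z; lia.
have c0 : cycle_dist x./2 x./2 = 0 by rewrite /cycle_dist; lia.
case=> yz [yzE|[oy oz /(cycle_dist_step x./2 _ _ xL yL zL)]].
  rewrite -yzE; case: (x =P y :> nat) => [xy|_].
    by rewrite -xy c0; case: eqP; lia.
  by move: (cycle_dist _ _) => c; case: eqP; lia.
case: (x =P y :> nat) => [xy|_].
  by move=> h; rewrite -xy c0 in h; case: eqP; lia.
by move: (cycle_dist _ _) (cycle_dist _ _) => c c' h; case: eqP; lia.
Qed.

Lemma stacked_dist_pred (x y : 'I_(2 * L)) : 0 < stacked_dist x y ->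
  exists2 z, stacked_adj z y & stacked_dist x y = (stacked_dist x z).+1.
Proof.
have xL : x./2 < L by have := ltn_ord x; lia.
have yL : y./2 < L by have := ltn_ord y; lia.
have c0 : cycle_dist x./2 x./2 = 0 by rewrite /cycle_dist; lia.
have ext (n : nat) : n < 2 * L -> n <> y ->
    n./2 = y./2 \/ [/\ odd n, odd y & cycle_dist n./2 y./2 = 1] ->
    stacked_dist x y =
      (if x == n :> nat then 0 else cycle_dist x./2 n./2 + ~~ odd x + ~~ odd n).+1 ->
  exists2 z, stacked_adj z y & stacked_dist x y = (stacked_dist x z).+1.
  by move=> nL ny adj dE; exists (Ordinal nL) => //; apply/stacked_adjP.
have yL' := ltn_ord y; have xL' := ltn_ord x.
case: (x =P y) => [->|/eqP]; first by rewrite /stacked_dist eqxx.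
rewrite -val_eqE => xy _.
have dE : stacked_dist x y = cycle_dist x./2 y./2 + ~~ odd x + ~~ odd y.
  by rewrite /stacked_dist -val_eqE (negPf xy).
have {}xy : x <> y :> nat by apply/eqP.
rewrite dE in ext *.
(* The predecessor of a leaf y is y + 1. For odd y it is x when x is the leaf at y, and otherwise
   the odd vertex at the preceding cycle position. *)
case: (orP (orbN (odd y))) => oy; last first.
  have y2 : (y.+1)./2 = y./2 by lia.
  apply: (ext y.+1); [lia|lia|by left|rewrite y2].
  case: (x =P y.+1 :> nat) => h; last by rewrite /= !oy; lia.
  by rewrite -y2 -h c0 h /= !oy.
have [e|ij] := eqVneq x./2 y./2.
  apply: (ext x) => //; first by left.
  by rewrite eqxx -e c0; lia.
have [j [jL j1 jd]] := cycle_dist_pred _ _ xL yL (elimN eqP ij).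
have j2 : (2 * j + 1)./2 = j by lia.
apply: (ext (2 * j + 1)); [lia| |by right; rewrite j2; split => //; lia|].
  by move=> h; move: j1; rewrite -h j2 /cycle_dist; lia.
rewrite j2 jd; case: eqP => h; last by lia.
have -> : x./2 = j by rewrite h.
by rewrite /cycle_dist; lia.
Qed.

Lemma stacked_dist_max (x y : 'I_(2 * L)) :
  stacked_dist x y <= L./2 + ~~ odd x + ~~ odd y.
Proof.
rewrite /stacked_dist /cycle_dist; case: eqP => // _.
have := ltn_ord x; have := ltn_ord y; lia.
Qed.

Lemma gdist_stacked (x y : 'I_(2 * L)) : gdist (@stacked_adj L) x y = stacked_dist x y.
Proof.
apply: gdist_eq => //.
- exact: stacked_dist0.
- exact: stacked_dist0_eq.
- exact: stacked_dist_step.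
- exact: stacked_dist_pred.
by move=> {}x {}y; rewrite card_ord; have := stacked_dist_max x y; lia.
Qed.

Lemma ecc_stacked (x : 'I_(2 * L)) : ecc (@stacked_adj L) x = L./2 + ~~ odd x + 1.
Proof.
have xL := ltn_ord x.
apply/eqP; rewrite eqn_leq; apply/andP; split.
  apply/bigmax_leqP => y _; rewrite gdist_stacked.
  by apply: leq_trans (stacked_dist_max x y) _; lia.
(* A farthest vertex: the leaf at the position [L./2] steps further around the cycle. *)
have yL : 2 * ((x./2 + L./2) %% L) < 2 * L by rewrite ltn_mul2l /= ltn_mod; lia.
apply: leq_trans (leq_bigmax (Ordinal yL)).
rewrite gdist_stacked /stacked_dist /cycle_dist -val_eqE /=.
have [h|h] := ltnP (x./2 + L./2) L.
  by rewrite modn_small //; case: eqP; lia.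
have -> : (x./2 + L./2) %% L = x./2 + L./2 - L.
  by rewrite -{1}(subnK h) modnDr modn_small //; lia.
by case: eqP; lia.
Qed.

End Stacked.

(** * Eccentricities in terms of the class order *)

Theorem proposition30
    (p : nat) (p_prime : prime p)
    (p_mod : p %% 120 = 71 \/ p %% 120 = 119)
    (P : algC -> Prop) (P_prime : is_prime_ideal p P) (P_above : lies_above 2 P)
    (L : nat) (L_order : is_class_order p P L)
    (v : 'I_(2 * L)) :
  ((ecc (@stacked_adj L) v)%:R : rat)%R
    = (if (2 %| v)%N then 1 / 2%:R * (L%:R + 3%:R) else 1 / 2%:R * (L%:R + 1))%R.
Proof.
have p8 : 8 < p by case: p_mod; lia.
(* Both residues are 7 modulo 8, so k = (p + 1) / 4 is an even integer. *)
have pk : (p%:Z + 1 = 4 * ((p.+1 %/ 4)%N)%:Z)%R by case: p_mod; lia.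
have k2 : (2 %| ((p.+1 %/ 4)%N)%:Z)%Z by case: p_mod; lia.
have [s s2 PP] := prime_above_two p _ P p_prime pk k2 P_prime P_above.
have [Lodd L3] := class_order_odd_ge3 p _ s p_prime s2 pk k2 P PP L p8 L_order.
have LE : (L%:R = 1 + 2%:R * L./2%:R :> rat)%R.
  by rewrite -[in LHS](odd_double_half L) Lodd -muln2 natrD natrM mulrC.
rewrite ecc_stacked // dvdn2 LE.
by case: (odd v) => /=; rewrite !natrD; field.
Qed.
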